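(* Let $(\beta_{ij})=(b_{ij}+ig^{ij})$ with $b=(b_{ij})$ real symmetric and $(g^{ij})=(g_{ij})^{-1}$ real, symmetric and positive definite; write $\beta=b+ig^{-1}$, $V=\sqrt{\det(g_{ij})}$, and $\Omega=V\bigwedge_{i=1}^n\big(dx_i+\sum_j\beta_{ij}dy_j\big)$. Then $d\Omega=0$ if and only if all of the following hold: (1) $F_b+\tfrac12[g^{-1},g^{-1}]=0$; (2) $\nabla_bg^{-1}=0$; (3) $dx_1,\dots,dx_n$ are harmonic forms on each fibre (with respect to the metric $g$); (4) $V\,dx_1\wedge\cdots\wedge dx_n$ is parallel.
   Context: $f^\#:X^\#\to B$ is a fibration of the form $X^\#=\mathcal{T}_B^*/\Lambda$, where $B$ is a real $n$-manifold and $\Lambda\subseteq\mathcal{T}_B^*$ is a closed, étale, Lagrangian family of discrete subgroups of the fibres (the complement of the critical locus in an integral special Lagrangian fibration with Lagrangian section), with symplectic form $\omega=\sum_idx_i\wedge dy_i$ in canonical coordinates ($y_1,\dots,y_n$ local coordinates on $B$, $x_1,\dots,x_n$ the fibre coordinates of the covector $\sum x_idy_i$). $b_{ij},g_{ij}$ are $C^\infty$ functions of $(x,y)$ in each such coordinate system such that $\Omega$ is globally defined on $X^\#$; $\sum g_{ij}dx_idx_j$ is the metric on the fibres. Identify $b$ and $g^{-1}$ with $$b=\sum_{i,j}b_{ij}dy_j\otimes\frac{\partial}{\partial x_i},\qquad g^{-1}=\sum_{i,j}g^{ij}dy_j\otimes\frac{\partial}{\partial x_i}.$$ For $v=\sum_jdy_j\otimes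 v_j$, $w=\sum_jdy_j\otimes w_j$ with $v_j=\sum_iv_{ij}\partial/\partial x_i$, $w_j=\sum_iw_{ij}\partial/\partial x_i$, put $[v,w]=\sum_{l,m}[v_l,w_m]\,dy_l\wedge dy_m$, where $[v_l,w_m]$ is the Lie bracket of vector fields (differentiating in the $x$ variables), and $d_yv=\sum_{i,j,k}\frac{\partial v_{ij}}{\partial y_k}dy_k\wedge dy_j\otimes\frac{\partial}{\partial x_i}$. $b$ defines an Ehresmann connection on $f^\#$ with horizontal subspaces spanned by $\partial/\partial y_j-\sum_ib_{ij}\partial/\partial x_i$. Its covariant derivative is $\nabla_b\alpha=d_y\alpha-[b,\alpha]$ and its curvature is $F_b=d_yb-\frac12[b,b]$. A family of forms along the fibres, $\alpha=\sum_If_Idx_I$, is parallel if $\frac{\partial\alpha}{\partial y_j}-\mathcal{L}_{\sum_ib_{ij}\partial/\partial x_i}\alpha=0$ for each $j$ ($\mathcal{L}$ the Lie derivative along the fibre). *)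

(* Defs.v *)
From HB Require Import structures.
From mathcomp Require Import all_boot all_order all_algebra.
From mathcomp Require Export complex.
From mathcomp Require Import all_classical all_reals all_analysis.

Set Implicit Arguments.
Unset Strict Implicit.
Unset Printing Implicit Defensive.

Import Order.TTheory GRing.Theory Num.Theory.
Import numFieldNormedType.Exports.

Local Open Scope classical_set_scope.
Local Open Scope ring_scope.
Local Open Scope complex_scope.

(* Conventions.
   - Canonical coordinates of a covector \sum_i x_i dy_i are collected in a
     single row [row_mx x y] of 'rV_(n + n): fibre coordinates x first, base
     coordinates y second.
   - A k-form is a function of a point and of a k-row matrix whose rows are the
     k tangent vectors it is evaluated on. *)

(* ------------------------------------------------------------------------ *)
(* Smooth functions and forms on open subsets of R^N *)

Section Calculus.
Variable R : realType.

Fixpoint Ck_on (N k : nat) (U : set 'rV[R]_N) (f : 'rV[R]_N -> R) : Prop :=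
  if k is k'.+1 then
    (forall p, U p -> differentiable f p) /\
    (forall i : 'I_N, Ck_on k' U (fun p => 'D_(delta_mx 0 i) f p))
  else forall p, U p -> {for p, continuous f}.

Definition smooth_on (N : nat) (U : set 'rV[R]_N) (f : 'rV[R]_N -> R) : Prop :=
  forall k, Ck_on k U f.

Definition smooth_map_on (M N : nat) (U : set 'rV[R]_M)
    (F : 'rV[R]_M -> 'rV[R]_N) : Prop :=
  forall i, smooth_on U (fun p => F p 0 i).

(* Exterior derivative, on constant vectors:
   (d alpha)(v_0, .., v_k) = \sum_i (-1)^i v_i(alpha(.., v_i omitted, ..)).
   [lift] embeds the m-dimensional space carrying the forms in the ambient
   coordinate space: the identity for d on the total space, the inclusion of
   the vertical directions for d along the fibres. *)
Definition dext (m N k : nat) (lift : 'rV[R]_m -> 'rV[R]_N)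
    (alpha : 'rV[R]_N -> 'M[R]_(k, m) -> R)
    (p : 'rV[R]_N) (v : 'M[R]_(k.+1, m)) : R :=
  \sum_(i < k.+1)
    (-1) ^+ i * 'D_(lift (row i v)) (fun q => alpha q (row' i v)) p.

Definition dextC (N k : nat) (alpha : 'rV[R]_N -> 'M[R]_(k, N) -> R[i])
    (p : 'rV[R]_N) (v : 'M[R]_(k.+1, N)) : R[i] :=
  dext id (fun q w => complex.Re (alpha q w)) p v +i*
  dext id (fun q w => complex.Im (alpha q w)) p v.

Definition pullback (M N k : nat) (F : 'rV[R]_M -> 'rV[R]_N)
    (alpha : 'rV[R]_N -> 'M[R]_(k, N) -> R[i])
    (p : 'rV[R]_M) (v : 'M[R]_(k, M)) : R[i] :=
  alpha (F p) (v *m jacobian F p).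

(* (theta_1 /\ .. /\ theta_k)(v_1, .., v_k) = det (theta_i (v_j)) *)
Definition wedge (T : comNzRingType) (N k : nat)
    (theta : 'I_k -> 'rV[R]_N -> T) (v : 'M[R]_(k, N)) : T :=
  \det (\matrix_(j < k, i < k) theta i (row j v)).

Definition sym_posdef (n : nat) (A : 'M[R]_n) : Prop :=
  A^T = A /\ forall u : 'rV[R]_n, u != 0 -> 0 < (u *m A *m u^T) 0 0.

End Calculus.

(* ------------------------------------------------------------------------ *)
(* Manifolds, cotangent bundles and X^# = T_B^*/Lambda *)

Record smooth_manifold (R : realType) (n : nat) := SmoothManifold {
  carrier : topologicalType ;
  carrier_hausdorff : hausdorff_space carrier ;
  carrier_second_countable : @second_countable carrier ;
  chart : Type ;
  dom : chart -> set carrier ;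
  coord : chart -> carrier -> 'rV[R]_n ;
  param : chart -> 'rV[R]_n -> carrier ;
  dom_open : forall a, open (dom a) ;
  dom_cover : forall q, exists a, dom a q ;
  codom_open : forall a, open (coord a @` dom a) ;
  coordK : forall a q, dom a q -> param a (coord a q) = q ;
  coord_continuous : forall a q, dom a q -> {for q, continuous (coord a)} ;
  param_continuous : forall a y, (coord a @` dom a) y ->
    {for y, continuous (param a)} ;
  transition_smooth : forall a c,
    smooth_map_on (coord a @` (dom a `&` dom c)) (coord c \o param a)
}.

Section Cotangent.
Variables (R : realType) (n : nat) (B : smooth_manifold R n).

Definition transition (a c : chart B) : 'rV[R]_n -> 'rV[R]_n :=
  coord c \o param a.

(* The open set over which the canonical coordinates of chart [a] range. *)
Definition tdom (a : chart B) : set 'rV[R]_(n + n) :=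
  [set p | (coord a @` dom a) (rsubmx p)].

Definition toverlap (a c : chart B) : set 'rV[R]_(n + n) :=
  [set p | (coord a @` (dom a `&` dom c)) (rsubmx p)].

(* \sum_j x_j dy_j = \sum_i x'_i dy'_i, i.e. x'_i = \sum_j x_j dy_j/dy'_i. *)
Definition cotransition (a c : chart B) (p : 'rV[R]_(n + n)) : 'rV[R]_(n + n) :=
  let y' := transition a c (rsubmx p) in
  row_mx (lsubmx p *m (jacobian (transition c a) y')^T) y'.

Definition dx (i : 'I_n) (u : 'rV[R]_(n + n)) : R := u 0 (lshift n i).
Definition dy (j : 'I_n) (u : 'rV[R]_(n + n)) : R := u 0 (rshift n j).

(* omega = \sum_i dx_i /\ dy_i *)
Definition omega (u w : 'rV[R]_(n + n)) : R :=
  \sum_(i < n) (dx i u * dy i w - dx i w * dy i u).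

(* The graph in T_B^* of the 1-form with coefficients [s]. *)
Definition graph_map (s : 'rV[R]_n -> 'rV[R]_n) (y : 'rV[R]_n) :
  'rV[R]_(n + n) := row_mx (s y) y.

Definition lagrangian_on (W : set 'rV[R]_n) (s : 'rV[R]_n -> 'rV[R]_n) : Prop :=
  forall y, W y -> forall e e' : 'rV[R]_n,
    omega (e *m jacobian (graph_map s) y) (e' *m jacobian (graph_map s) y) = 0.

(* Lambda, described by its subset of each canonical coordinate domain. The
   last field says that Lambda is, near each of its points, the graph of a
   smooth section over an open subset of B (so that Lambda -> B is a local
   homeomorphism), and that this graph is Lagrangian. *)
Record lagrangian_lattice := LagrangianLattice {
  lat : chart B -> set 'rV[R]_(n + n) ;
  lat_sub_tdom : forall a, lat a `<=` tdom a ;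
  lat_cotransition : forall a c p, toverlap a c p ->
    (lat a p <-> lat c (cotransition a c p)) ;
  lat0 : forall a y, (coord a @` dom a) y -> lat a (row_mx 0 y) ;
  latB : forall a y x x', lat a (row_mx x y) -> lat a (row_mx x' y) ->
    lat a (row_mx (x - x') y) ;
  lat_discrete : forall a p, lat a p ->
    \forall q \near p, lat a q -> rsubmx q = rsubmx p -> q = p ;
  lat_closed : forall a, closure (lat a) `&` tdom a `<=` lat a ;
  lat_etale_lagrangian : forall a p, lat a p ->
    exists (N : set 'rV[R]_(n + n)) (W : set 'rV[R]_n)
           (s : 'rV[R]_n -> 'rV[R]_n),
      [/\ open N /\ N p,
          open W /\ W `<=` coord a @` dom a,
          smooth_map_on W s,
          lat a `&` N = graph_map s @` W
        & lagrangian_on W s]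
}.

Variable L : lagrangian_lattice.

Definition lat_section (a : chart B) (W : set 'rV[R]_n)
    (s : 'rV[R]_n -> 'rV[R]_n) : Prop :=
  [/\ open W, W `<=` coord a @` dom a, smooth_map_on W s
    & forall y, W y -> lat L a (graph_map s y)].

Definition translation (s : 'rV[R]_n -> 'rV[R]_n) (p : 'rV[R]_(n + n)) :
  'rV[R]_(n + n) := row_mx (lsubmx p + s (rsubmx p)) (rsubmx p).

(* Two canonical coordinate systems of X^# differ by a change of chart of B and
   by translation by a section of Lambda: a k-form on X^# is a family of k-forms
   in canonical coordinates that is compatible with both. *)
Definition globally_defined (k : nat)
    (alpha : chart B -> 'rV[R]_(n + n) -> 'M[R]_(k, n + n) -> R[i]) : Prop :=
  (forall a c p v, toverlap a c p ->
     alpha a p v = pullback (cotransition a c) (alpha c) p v) /\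
  (forall a W s, lat_section a W s ->
     forall p v, W (rsubmx p) ->
       alpha a p v = pullback (translation s) (alpha a) p v).

Definition closed_form (k : nat)
    (alpha : chart B -> 'rV[R]_(n + n) -> 'M[R]_(k, n + n) -> R[i]) : Prop :=
  forall a p v, tdom a p -> dextC (alpha a) p v = 0.

End Cotangent.

(* ------------------------------------------------------------------------ *)
(* Objects in one canonical coordinate system *)

Section Canonical.
Variables (R : realType) (n : nat).
Implicit Types (p q : 'rV[R]_(n + n)).

Definition vert (xi : 'rV[R]_n) : 'rV[R]_(n + n) := row_mx xi 0.

Definition d_dy (j : 'I_n) : 'rV[R]_(n + n) := delta_mx 0 (rshift n j).

Definition volume (g : 'rV[R]_(n + n) -> 'M[R]_n) p : R :=
  Num.sqrt (\det (g p)).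

Definition ginv (g : 'rV[R]_(n + n) -> 'M[R]_n) p : 'M[R]_n := invmx (g p).

Definition beta (b g : 'rV[R]_(n + n) -> 'M[R]_n) p (i j : 'I_n) : R[i] :=
  b p i j +i* ginv g p i j.

Definition Omega (b g : 'rV[R]_(n + n) -> 'M[R]_n) p
    (v : 'M[R]_(n, n + n)) : R[i] :=
  (volume g p)%:C *
  wedge (fun i u => (dx i u)%:C + \sum_(j < n) beta b g p i j * (dy j u)%:C) v.

(* A matrix-valued function v stands for \sum_(i, j) v_ij dy_j (x) d/dx_i; its
   vertical vector fields v_j are the columns. *)
Definition vfield (v : 'rV[R]_(n + n) -> 'M[R]_n) (j : 'I_n) p : 'rV[R]_n :=
  \row_i v p i j.

(* Lie bracket of vertical vector fields. *)
Definition lie (xi eta : 'rV[R]_(n + n) -> 'rV[R]_n) p : 'rV[R]_n :=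
  'D_(vert (xi p)) eta p - 'D_(vert (eta p)) xi p.

(* (dy_l /\ dy_m)(u_0, u_1) *)
Definition dy2 (l m : 'I_n) (u : 'M[R]_(2, n)) : R :=
  u ord0 l * u ord_max m - u ord_max l * u ord0 m.

(* 2-forms in the dy_j with values in vertical vectors, evaluated at the pair
   of base vectors given by the rows of [u]. *)
Definition ybracket (v w : 'rV[R]_(n + n) -> 'M[R]_n) p (u : 'M[R]_(2, n)) :
    'rV[R]_n :=
  \sum_(l < n) \sum_(m < n) dy2 l m u *: lie (vfield v l) (vfield w m) p.

Definition d_y (v : 'rV[R]_(n + n) -> 'M[R]_n) p (u : 'M[R]_(2, n)) :
    'rV[R]_n :=
  \row_i \sum_(j < n) \sum_(k < n)
    'D_(d_dy k) (fun q => v q i j) p * dy2 k j u.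

Definition nabla (b alpha : 'rV[R]_(n + n) -> 'M[R]_n) p (u : 'M[R]_(2, n)) :
    'rV[R]_n :=
  d_y alpha p u - ybracket b alpha p u.

Definition curvature (b : 'rV[R]_(n + n) -> 'M[R]_n) p (u : 'M[R]_(2, n)) :
    'rV[R]_n :=
  d_y b p u - 2^-1 *: ybracket b b p u.

(* Families of k-forms along the fibres. *)
Definition dfib (k : nat) (alpha : 'rV[R]_(n + n) -> 'M[R]_(k, n) -> R) :=
  dext vert alpha.

(* (L_xi alpha)(v_1, .., v_k) =
     xi (alpha(v_1, .., v_k)) - \sum_i alpha(v_1, .., [xi, v_i], .., v_k),
   on constant vector fields v_i. *)
Definition lie_derivative (k : nat) (xi : 'rV[R]_(n + n) -> 'rV[R]_n)
    (alpha : 'rV[R]_(n + n) -> 'M[R]_(k, n) -> R) p (v : 'M[R]_(k, n)) : R :=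
  'D_(vert (xi p)) (fun q => alpha q v) p -
  \sum_(i < k)
    alpha p (\matrix_(a < k)
      (if a == i then lie xi (fun=> row i v) p else row a v)).

Definition parallel_on (k : nat) (U : set 'rV[R]_(n + n))
    (b : 'rV[R]_(n + n) -> 'M[R]_n)
    (alpha : 'rV[R]_(n + n) -> 'M[R]_(k, n) -> R) : Prop :=
  forall p, U p -> forall (j : 'I_n) (v : 'M[R]_(k, n)),
    'D_(d_dy j) (fun q => alpha q v) p -
    lie_derivative (vfield b j) alpha p v = 0.

(* Hodge star along the fibres for the metric \sum g_ij dx_i dx_j:
   ( *alpha)_(i_{k+1} .. i_n) =
     1/k! \sum_J alpha^(j_1 .. j_k) sqrt(det g) epsilon_(j_1 .. j_k i_{k+1} .. i_n)
   where alpha^J = alpha (g^{-1} dx_{j_1}, .., g^{-1} dx_{j_k}). *)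
Definition hodge (k : nat) (kn : (k <= n)%N) (g : 'rV[R]_(n + n) -> 'M[R]_n)
    (alpha : 'rV[R]_(n + n) -> 'M[R]_(k, n) -> R) p
    (w : 'M[R]_(n - k, n)) : R :=
  (k`!%:R)^-1 * \sum_(J : {ffun 'I_k -> 'I_n})
    alpha p (rowsub J (ginv g p)) * volume g p *
    \det (castmx (subnKC kn, erefl n) (col_mx (rowsub J 1%:M) w)).

(* The fibres of X^# need not be compact: harmonic means closed and
   co-closed. *)
Definition harmonic_on (k : nat) (kn : (k <= n)%N) (U : set 'rV[R]_(n + n))
    (g : 'rV[R]_(n + n) -> 'M[R]_n)
    (alpha : 'rV[R]_(n + n) -> 'M[R]_(k, n) -> R) : Prop :=
  forall p, U p ->
    (forall v, dfib alpha p v = 0) /\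
    (forall w, dfib (hodge kn g alpha) p w = 0).

Definition dx_fib (i : 'I_n) (p : 'rV[R]_(n + n)) (v : 'M[R]_(1, n)) : R :=
  v 0 i.

(* The proof term is the bound 1 <= n required by [hodge]. *)
Definition dx_harmonic_on (U : set 'rV[R]_(n + n))
    (g : 'rV[R]_(n + n) -> 'M[R]_n) (i : 'I_n) : Prop :=
  harmonic_on (leq_ltn_trans (leq0n i) (ltn_ord i)) U g (dx_fib i).

(* V dx_1 /\ .. /\ dx_n *)
Definition volume_form (g : 'rV[R]_(n + n) -> 'M[R]_n) p (v : 'M[R]_n) : R :=
  volume g p * wedge (fun (i : 'I_n) (u : 'rV[R]_n) => u 0 i) v.

End Canonical.

(* Main.v *)
(* The theorem is pointwise. In canonical coordinates put
   theta_i = dx_i + \sum_j beta_ij dy_j and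
   D_k = d/dy_k - \sum_l beta_lk d/dx_l, so that
   d beta_ij = \sum_k (d beta_ij / dx_k) theta_k + \sum_k (D_k beta_ij) dy_k.
   Expanding d Omega in the basis theta_1, .., theta_n, dy_1, .., dy_n leaves, up
   to sign, two kinds of terms:
     (D_j V - V \sum_i d beta_ij / dx_i) dy_j /\ theta_1 /\ .. /\ theta_n,
     V (D_k beta_ij - D_j beta_ik) dy_k /\ dy_j /\ (theta's without theta_i).
   The real and imaginary parts of the coefficients of the second kind are the
   components of F_b + [g^-1, g^-1]/2 and of nabla_b g^-1. The real part of the
   coefficient of the first kind measures the failure of V dx_1 /\ .. /\ dx_n to
   be parallel, its imaginary part is - \sum_l d(V g^lj)/dx_l, the codifferential
   of dx_j up to a factor. The coefficients are recovered by evaluating d Omega on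
   real coordinate frames containing one, resp. two, base vectors d/dy_j. *)

Require Import Defs.
From HB Require Import structures.
From mathcomp Require Import all_boot all_order all_fingroup all_algebra.
From mathcomp Require Import all_classical all_reals all_analysis.
From mathcomp Require Import ring.

Set Implicit Arguments.
Unset Strict Implicit.
Unset Printing Implicit Defensive.

Import Order.TTheory GRing.Theory Num.Theory.
Import numFieldNormedType.Exports.
Local Open Scope classical_set_scope.
Local Open Scope ring_scope.

(** * Determinants: row replacement, and wedge products of 1-forms as determinants *)

Section Determinants.
Variable T : comNzRingType.

Definition set_row (m n : nat) (i : 'I_m) (d : 'rV[T]_n) (A : 'M[T]_(m, n)) :=
  \matrix_(a, b) (if a == i then d 0 b else A a b).

Lemma set_row_id (m n : nat) (i : 'I_m) (A : 'M[T]_(m, n)) :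
  set_row i (row i A) A = A.
Proof. by apply/matrixP => a b; rewrite !mxE; case: eqP => // ->. Qed.

Lemma col'_set_row (m n : nat) (i : 'I_m) (c : 'I_n) (d : 'rV[T]_n)
    (A : 'M[T]_(m, n)) :
  col' c (set_row i d A) = set_row i (col' c d) (col' c A).
Proof. by apply/matrixP => a b; rewrite !mxE. Qed.

Lemma det_set_row (n : nat) (i : 'I_n) (d : 'rV[T]_n) (A : 'M[T]_n) :
  \det (set_row i d A) = \sum_b d 0 b * cofactor A i b.
Proof.
rewrite (expand_det_row _ i); apply: eq_bigr => b _; rewrite mxE eqxx.
congr (_ * (_ * \det _)); apply/matrixP => a c.
by rewrite !mxE eq_sym (negPf (neq_lift _ _)).
Qed.

(** Expanding each determinant along its replaced row gives the trace of [v *m J *m \adj v], and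
    [\adj v *m v] is scalar. This produces the divergence in the Lie derivative of a volume form. *)
Lemma sum_det_set_row_mulmx (n : nat) (v J : 'M[T]_n) :
  \sum_i \det (set_row i (row i v *m J) v) = \tr J * \det v.
Proof.
have -> : \tr J * \det v = \tr (v *m (J *m \adj v)).
  by rewrite mxtrace_mulC -mulmxA mul_adj_mx -scalemx1 -scalemxAr mulmx1
     mxtraceZ mulrC.
apply: eq_bigr => i _; rewrite det_set_row mulmxA [RHS]mxE.
by apply: eq_bigr => b _; rewrite -row_mul mxE [\adj v b i]mxE.
Qed.

Lemma cofactor1 (n : nat) (i j : 'I_n) : cofactor (1%:M : 'M[T]_n) i j = (i == j)%:R.
Proof.
have := mul_adj_mx (1%:M : 'M[T]_n); rewrite mulmx1 det1 => /matrixP /(_ j i).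
by rewrite !mxE eq_sym.
Qed.

(** When [c] and the rows of [Q] list the values of 1-forms on n + 1 vectors, this is the value of
    their wedge product on these vectors. *)
Definition det_cons (n : nat) (c : 'rV[T]_n.+1) (Q : 'M[T]_(n, n.+1)) : T :=
  \det (col_mx c Q : 'M[T]_(1 + n)).

Lemma det_consE (n : nat) (c : 'rV[T]_n.+1) (Q : 'M[T]_(n, n.+1)) :
  det_cons c Q = \sum_(a < n.+1) (-1) ^+ a * (c 0 a * \det (col' a Q)).
Proof.
rewrite /det_cons (expand_det_row _ (lshift n (0 : 'I_1))).
apply: eq_bigr => a _; rewrite col_mxEu mulrCA.
congr (_ * (_ * \det _)); apply/matrixP => x y; rewrite [LHS]mxE [LHS]mxE.
have -> : lift (lshift n (0 : 'I_1)) x = rshift 1 x by apply: val_inj.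
by rewrite col_mxEd mxE.
Qed.

Lemma det_cons_sum (n : nat) (I : finType) (x : I -> T)
    (c : I -> 'rV[T]_n.+1) (Q : 'M[T]_(n, n.+1)) :
  det_cons (\sum_k x k *: c k) Q = \sum_k x k * det_cons (c k) Q.
Proof.
under [RHS]eq_bigr do rewrite det_consE big_distrr /=.
rewrite exchange_big det_consE; apply: eq_bigr => a _ /=.
rewrite summxE big_distrl big_distrr /=; apply: eq_bigr => k _.
by rewrite mxE; ring.
Qed.

Lemma det_consD (n : nat) (c d : 'rV[T]_n.+1) (Q : 'M[T]_(n, n.+1)) :
  det_cons (c + d) Q = det_cons c Q + det_cons d Q.
Proof.
by rewrite !det_consE -big_split; apply: eq_bigr => a _ /=; rewrite mxE; ring.
Qed.

Lemma det_cons_alt (n : nat) (i : 'I_n) (c : 'rV[T]_n.+1) (Q : 'M[T]_(n, n.+1)) :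
  det_cons c (set_row i c Q) = 0.
Proof.
apply: (@determinant_alternate _ _ _ (lshift n 0) (rshift 1 i)) => // a.
by rewrite -[LHS]/((col_mx _ _) _ a) -[RHS]/((col_mx _ _) _ a) col_mxEu col_mxEd mxE eqxx.
Qed.

Lemma det_cons_swap (n : nat) (i : 'I_n) (c d : 'rV[T]_n.+1)
    (Q : 'M[T]_(n, n.+1)) :
  det_cons d (set_row i c Q) = - det_cons c (set_row i d Q).
Proof.
pose s : 'S_(1 + n) := tperm (lshift n 0) (rshift 1 i).
rewrite /det_cons.
have -> : col_mx d (set_row i c Q) = row_perm s (col_mx c (set_row i d Q)).
  apply/matrixP => a b; rewrite [RHS]mxE -(splitK a) /s.
  case: (fintype.split a) => a' /=.
    by rewrite [a']ord1 tpermL col_mxEu col_mxEd mxE eqxx.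
  have [->|ai] := eqVneq a' i; first by rewrite tpermR col_mxEu col_mxEd mxE eqxx.
  rewrite tpermD //; last by rewrite (inj_eq (@rshift_inj _ _)) eq_sym.
  by rewrite !col_mxEd !mxE (negPf ai).
rewrite row_permE det_mulmx det_perm odd_tperm /=.
by rewrite expr1 mulN1r.
Qed.

Lemma det_cons_delta0 (n : nat) (Q : 'M[T]_(n, n.+1)) :
  det_cons (delta_mx 0 ord0) Q = \det (col' ord0 Q).
Proof.
rewrite det_consE big_ord_recl !mxE !eqxx /= expr0 !mul1r big1 ?addr0 // => a _.
by rewrite !mxE /= mul0r mulr0.
Qed.

Lemma det_cons_row (n : nat) (k : 'I_n) (P : 'M[T]_(n, n.+1)) :
  det_cons (row k P) P = 0.
Proof. by rewrite -{2}(set_row_id k P) det_cons_alt. Qed.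

(** Row k of [P] survives the replacement of row i unless k = i, so it occurs twice; for k = i a
    swap puts it back in place and moves [y] to the front. *)
Lemma det_cons_row_set_row (n : nat) (k i : 'I_n) (y : 'rV[T]_n.+1)
    (P : 'M[T]_(n, n.+1)) :
  det_cons (row k P) (set_row i y P) = - ((k == i)%:R * det_cons y P).
Proof.
have [->|ki] := eqVneq k i; first by rewrite det_cons_swap set_row_id mul1r.
rewrite mul0r oppr0 -(det_cons_alt k (row k P) (set_row i y P)); congr det_cons.
apply/matrixP => a b; rewrite !mxE.
by have [->|//] := eqVneq a k; rewrite (negPf ki).
Qed.

(** This is the Leibniz rule for d(V theta_1 /\ .. /\ theta_n), with dV and d beta_ij expanded in
    the theta_k (rows of [P]) and dy_k (rows of [Y]). The theta components of dV repeat a factor and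
    vanish; those of d beta_ij survive only at k = i, where a swap turns them into minus a
    divergence. *)
Lemma det_cons_leibniz (n : nat) (P Y : 'M[T]_(n, n.+1)) (V0 : T)
    (vx vy : 'I_n -> T) (bx beta_coef : 'I_n -> 'I_n -> 'I_n -> T) :
  det_cons (\sum_k vx k *: row k P + \sum_k vy k *: row k Y) P +
  V0 * \sum_i \sum_j
    det_cons (\sum_k bx k i j *: row k P + \sum_k beta_coef k i j *: row k Y)
      (set_row i (row j Y) P) =
  \sum_j (vy j - V0 * \sum_i bx i i j) * det_cons (row j Y) P +
  V0 * \sum_i \sum_j \sum_k
    beta_coef k i j * det_cons (row k Y) (set_row i (row j Y) P).
Proof.
rewrite det_consD !det_cons_sum big1 ?add0r; last first.
  by move=> k _; rewrite det_cons_row mulr0.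
have -> : \sum_i \sum_j
    det_cons (\sum_k bx k i j *: row k P + \sum_k beta_coef k i j *: row k Y)
      (set_row i (row j Y) P) =
   - (\sum_j (\sum_i bx i i j) * det_cons (row j Y) P) +
   \sum_i \sum_j \sum_k
    beta_coef k i j * det_cons (row k Y) (set_row i (row j Y) P).
  under [X in - X]eq_bigr do rewrite big_distrl /=.
  rewrite [X in - X]exchange_big /= -sumrN -big_split; apply: eq_bigr => i _ /=.
  rewrite -sumrN -big_split; apply: eq_bigr => j _ /=.
  rewrite det_consD !det_cons_sum; congr (_ + _).
  rewrite (bigD1 i) //= det_cons_row_set_row. rewrite eqxx mul1r mulrN big1 ?addr0 //.
  by move=> k ki; rewrite det_cons_row_set_row (negPf ki) mul0r oppr0 mulr0.
rewrite mulrDr addrA; congr (_ + _).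
rewrite mulrN mulr_sumr -sumrN -big_split; apply: eq_bigr => j _ /=.
by rewrite mulrBl mulrA.
Qed.

End Determinants.

(* With B = (beta_ij) and X, Y the x- and y-parts of n + 1 tangent vectors, the
   rows of P are the values of the theta_i; [det_cons (row j Y) P] is then
   dy_j /\ theta_1 /\ .. /\ theta_n evaluated on these vectors. *)
Definition leibniz_form (T : comNzRingType) (n : nat) (B : 'M[T]_n) (V0 : T)
    (vol_coef : 'I_n -> T) (beta_coef : 'I_n -> 'I_n -> 'I_n -> T)
    (X Y : 'M[T]_(n, n.+1)) : T :=
  let P := X + B *m Y in
  \sum_j vol_coef j * det_cons (row j Y) P +
  V0 * \sum_i \sum_j \sum_k
    beta_coef k i j * det_cons (row k Y) (set_row i (row j Y) P).

(* The x- and y-parts, transposed, of the frame d/dy_j0, d/dx_1, .., d/dx_n. *)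
Definition one_base_frame (T : comNzRingType) (n : nat) (j0 : 'I_n) :
    'M[T]_(n, n.+1) * 'M[T]_(n, n.+1) :=
  (\matrix_(i, a) (lift ord0 i == a)%:R,
   \matrix_(k, a) ((k == j0) && (a == ord0))%:R).

(* The frame d/dy_k0, d/dx_1, .., d/dx_n with d/dx_i0 replaced by d/dy_j0. *)
Definition two_base_frame (T : comNzRingType) (n : nat) (i0 j0 k0 : 'I_n) :
    'M[T]_(n, n.+1) * 'M[T]_(n, n.+1) :=
  (\matrix_(i, a) ((i != i0) && (lift ord0 i == a))%:R,
   \matrix_(k, a) (((k == k0) && (a == ord0)) ||
                   ((k == j0) && (a == lift ord0 i0)))%:R).

(** * Vanishing of the expanded form, tested on frames *)

Section Criterion.
Variables (T : numDomainType) (n : nat) (B : 'M[T]_n) (V0 : T)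
  (vol_coef : 'I_n -> T) (beta_coef : 'I_n -> 'I_n -> 'I_n -> T).

Local Notation expr := (leibniz_form B V0 vol_coef beta_coef).

(** Exchanging j and k keeps the coefficients and reverses the sign of the wedge product, so the
    inner sum equals its own opposite. *)
Lemma leibniz_form_eq0 (X Y : 'M[T]_(n, n.+1)) :
  (forall j, vol_coef j = 0) -> (forall k i j, beta_coef k i j = beta_coef j i k) ->
  expr X Y = 0.
Proof.
move=> d0 sym; rewrite /leibniz_form big1 ?add0r => [|j _]; last by rewrite d0 mul0r.
rewrite big1 ?mulr0 // => i _; set S := (X in X = 0).
have /eqP : S = - S.
  rewrite {1}/S exchange_big -sumrN; apply: eq_bigr => j _ /=.
  rewrite -sumrN; apply: eq_bigr => k _ /=.
  by rewrite sym det_cons_swap mulrN.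
by rewrite -subr_eq0 opprK -mulr2n mulrn_eq0 /= => /eqP.
Qed.

(** The dy's are nonzero only on the first vector. Deleting its column leaves the identity for the
    theta's and kills every term with a second dy factor. *)
Lemma leibniz_form_one_base (j0 : 'I_n) :
  expr (one_base_frame T j0).1 (one_base_frame T j0).2 = vol_coef j0.
Proof.
set X := _.1; set Y := _.2; rewrite /leibniz_form; set P := X + _.
have rY k : row k Y = (k == j0)%:R *: delta_mx 0 ord0.
  by apply/rowP => a; rewrite !mxE mulr_natl; case: eqP; case: eqP.
have cY (j : 'I_n) : col' ord0 (row j Y) = 0.
  by apply/rowP => a; rewrite !mxE andbF.
have cP : col' ord0 P = 1%:M.
  apply/matrixP => i a; rewrite !mxE (inj_eq (@lift_inj _ _)) big1 ?addr0 // => k _.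
  by rewrite !mxE andbF mulr0.
have dE k Q : det_cons (row k Y) Q = (k == j0)%:R * \det (col' ord0 Q).
  rewrite rY -det_cons_delta0 !det_consE big_distrr; apply: eq_bigr => a _ /=.
  by rewrite !mxE; ring.
rewrite [X in V0 * X]big1 ?mulr0 ?addr0 => [|i _]; last first.
  rewrite big1 // => j _; rewrite big1 // => k _.
  rewrite dE col'_set_row cY det_set_row big1 ?mulr0 // => b _.
  by rewrite mxE mul0r.
rewrite (bigD1 j0) //= dE eqxx cP det1 !mulr1 big1 ?addr0 // => k kj.
by rewrite dE (negPf kj) mul0r mulr0.
Qed.

Lemma leibniz_form_two_base (i0 j0 k0 : 'I_n) : (forall j, vol_coef j = 0) ->
  expr (two_base_frame T i0 j0 k0).1 (two_base_frame T i0 j0 k0).2 =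
  V0 * (beta_coef k0 i0 j0 - beta_coef j0 i0 k0).
Proof.
move=> d0; set X := _.1; set Y := _.2; rewrite /leibniz_form; set P := X + _.
rewrite big1 ?add0r => [|j _]; last by rewrite d0 mul0r.
congr (_ * _).
pose e0 : 'rV[T]_n.+1 := delta_mx 0 ord0.
pose e1 : 'rV[T]_n.+1 := delta_mx 0 (lift ord0 i0).
have dE k Q : det_cons (row k Y) Q =
    (k == k0)%:R * det_cons e0 Q + (k == j0)%:R * det_cons e1 Q.
  rewrite !det_consE !big_distrr -big_split; apply: eq_bigr => a _ /=.
  rewrite !mxE eqxx /=; case: (k == k0); case: (k == j0) => /=;
    (have [->|_] := eqVneq a ord0; first by rewrite ?(negPf (neq_lift _ _)) /=; ring);
    by case: (a == lift ord0 i0) => /=; ring.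
(* Without column 0, [P] differs from the identity only in column [i0]; the cofactors of that column
   are therefore those of the identity. *)
have e0E i d : det_cons e0 (set_row i d P) = d 0 (lift ord0 i0) * (i == i0)%:R +
     \sum_(b | b != i0) d 0 (lift ord0 b) * cofactor (col' ord0 P) i b.
  rewrite det_cons_delta0 col'_set_row det_set_row (bigD1 i0) //= !mxE.
  congr (_ * _ + _); last by apply: eq_bigr => b _; rewrite mxE.
  rewrite -cofactor1; congr (_ * \det _); apply/matrixP => a b; rewrite !mxE.
  rewrite !(inj_eq (@lift_inj _ _)) big1 ?addr0 => [|k _]; last first.
    rewrite !mxE andbF (inj_eq (@lift_inj _ _)).
    by rewrite [lift i0 b == i0]eq_sym (negPf (neq_lift _ _)) andbF mulr0.
  have [->|_] := eqVneq (lift i a) i0; last by [].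
  by rewrite (negPf (neq_lift _ _)).
have e0Y i j : det_cons e0 (set_row i (row j Y) P) = (j == j0)%:R * (i == i0)%:R.
  rewrite e0E !mxE eqxx andbF andbT /= big1 ?addr0 // => b bi.
  by rewrite !mxE (inj_eq (@lift_inj _ _)) (negPf bi) !andbF mul0r.
have e0e1 i : det_cons e0 (set_row i e1 P) = (i == i0)%:R.
  rewrite e0E !mxE !eqxx mul1r big1 ?addr0 // => b bi.
  by rewrite !mxE (inj_eq (@lift_inj _ _)) (negPf bi) mul0r.
(* The swap brings row j of [Y] to the front, where its [e1] component meets the copy of [e1] in row
   i and drops out. *)
have e1Y i j : det_cons e1 (set_row i (row j Y) P) = - ((j == k0)%:R * (i == i0)%:R).
  by rewrite det_cons_swap dE det_cons_alt mulr0 addr0 e0e1.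
rewrite (bigD1 i0) //= [X in _ + X]big1 ?addr0 => [|i ii]; last first.
  rewrite big1 // => j _; rewrite big1 // => k _.
  by rewrite dE e0Y e1Y (negPf ii) !mulr0 oppr0 mulr0 addr0 mulr0.
under eq_bigr => j _ do under eq_bigr => k _ do
  rewrite dE e0Y e1Y eqxx !mulr1 mulrN mulrBr.
have pick (f : 'I_n -> 'I_n -> T) j1 k1 :
    \sum_j \sum_k f k j * ((k == k1)%:R * (j == j1)%:R) = f k1 j1.
  rewrite (bigD1 j1) //= [X in _ + X]big1 ?addr0 => [|j jj]; last first.
    by rewrite big1 // => k _; rewrite (negPf jj) !mulr0.
  rewrite (bigD1 k1) //= [X in _ + X]big1 ?addr0 => [|k kk]; last first.
    by rewrite (negPf kk) !mul0r mulr0.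
  by rewrite !eqxx !mulr1.
under eq_bigr do rewrite sumrB.
by rewrite sumrB !pick.
Qed.
End Criterion.

(* det ((1 - x) A + x I) is a polynomial in x without root in [0, 1]. *)
Lemma det_posdef_gt0 (F : rcfType) (n : nat) (A : 'M[F]_n) :
  (forall u : 'rV[F]_n, u != 0 -> 0 < (u *m A *m u^T) 0 0) -> 0 < \det A.
Proof.
move=> posA; rewrite ltNge; apply/negP => detA_le0.
pose q := \det ((1 - 'X) *: map_mx polyC A + 'X%:M).
have qE x : q.[x] = \det ((1 - x) *: A + x%:M).
  rewrite -[LHS]/(horner_eval x q) -det_map_mx; congr (\det _).
  by apply/matrixP => i j; rewrite !mxE /= /horner_eval !(hornerE, hornerMn).
have [|x /andP[x_ge0 x_le1]] := @Num.Theory.poly_ivt _ q 0 1 ler01.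
  by rewrite !qE subr0 subrr scale1r scale0r add0r raddf0 addr0 detA_le0 det1 ler01.
(* A root gives a nonzero [u] in the kernel. Pairing with [u] makes a convex combination of its
   [A]-value and its squared norm vanish, although both are positive. *)
rewrite /root qE => /det0P[u u0 /(congr1 (fun w => (w *m u^T) 0 0))].
rewrite mul0mx [RHS]mxE mulmxDr mulmxDl mul_mx_scalar -scalemxAr -!scalemxAl.
have -> : ((1 - x) *: (u *m A *m u^T) + x *: (u *m u^T)) 0 0 =
    (1 - x) * (u *m A *m u^T) 0 0 + x * (u *m u^T) 0 0 by rewrite !mxE.
move=> /eqP; apply/negP.
have uu : 0 < (u *m u^T) 0 0.
  have [i ui] : exists i, u 0 i != 0.
    apply/existsP; apply: contraNT u0 => /existsPn u0.
    by apply/eqP/rowP => i; rewrite mxE; apply/eqP; rewrite -[_ == _]negbK u0.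
  rewrite mxE (bigD1 i) //= ltr_pwDl ?sumr_ge0 // => [|j _]; rewrite mxE -expr2.
    by rewrite exprn_even_gt0.
  exact: sqr_ge0.
move: (posA u u0) uu; set s := (u *m A *m _) 0 0; set t := (u *m _) 0 0 => s0 t0.
rewrite gt_eqF //.
have [->|x0] := eqVneq x 0; first by rewrite subr0 mul1r mul0r addr0.
apply: ltr_wpDl; first by apply: mulr_ge0; [rewrite subr_ge0|exact: ltW].
by apply: mulr_gt0; rewrite // lt0r x0.
Qed.

(** * Directional derivatives of real and complex functions and of determinants *)

Section Derivatives.
Variables (R : realType) (N : nat).
Implicit Types (p v : 'rV[R]_N).
Local Notation C := R[i].

(** Weaker than differentiability: directional derivatives exist and depend linearly on the
    direction. This is what the computation uses, and it transfers directly between functions that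
    agree near [p]. *)
Definition has_gradient (f : 'rV[R]_N -> R) p :=
  (forall v, derivable f p v) /\
  (forall v, 'D_v f p = \sum_k v 0 k * 'D_(delta_mx 0 k) f p).

Lemma differentiable_has_gradient (f : 'rV[R]_N -> R) p :
  differentiable f p -> has_gradient f p.
Proof.
move=> df; split=> v; first exact: diff_derivable.
rewrite deriveE // {1}[v]row_sum_delta linear_sum; apply: eq_bigr => k _.
by rewrite linearZ deriveE.
Qed.

Lemma near_has_gradient (f g : 'rV[R]_N -> R) p :
  (\near p, f p = g p) -> has_gradient f p -> has_gradient g p.
Proof.
move=> fg [df lf]; split=> v; first exact: near_eq_derivable (df v).
rewrite -(near_eq_derive v fg) lf; apply: eq_bigr => k _.
by rewrite (near_eq_derive _ fg).
Qed.

Lemma differentiable_prod (I : Type) (r : seq I) (F : I -> 'rV[R]_N -> R) p :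
  (forall i, differentiable (F i) p) ->
  differentiable (fun q => \prod_(i <- r) F i q) p.
Proof.
move=> dF; elim: r => [|i r IH].
  by under eq_fun do rewrite big_nil; exact: differentiable_cst.
by under eq_fun do rewrite big_cons; exact: differentiableM.
Qed.

Lemma differentiable_det (m : nat) (F : 'rV[R]_N -> 'M[R]_m) p :
  (forall i j, differentiable (fun q => F q i j) p) ->
  differentiable (fun q => \det (F q)) p.
Proof.
move=> dF.
have -> : (fun q => \det (F q)) =
    \sum_(s : 'S_m) (fun q => (-1) ^+ s * \prod_i F q i (s i)).
  by apply/funext => q; rewrite fct_sumE.
elim/big_ind : _ => [|f g df dg|s _]; first exact: differentiable_cst.
  exact: differentiableD.
by apply: differentiableM; [exact: differentiable_cst|exact: differentiable_prod].
Qed.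

Definition is_cderive p v (f : 'rV[R]_N -> C) (d : C) :=
  is_derive p v (fun q => complex.Re (f q)) (complex.Re d) /\
  is_derive p v (fun q => complex.Im (f q)) (complex.Im d).

Lemma is_cderive_cst p v (c : C) : is_cderive p v (fun=> c) 0.
Proof. by split; exact: is_derive_cst. Qed.

Lemma complex_ReD (x y : C) : complex.Re (x + y) = complex.Re x + complex.Re y.
Proof. exact: raddfD. Qed.

Lemma complex_ImD (x y : C) : complex.Im (x + y) = complex.Im x + complex.Im y.
Proof. exact: raddfD. Qed.

Lemma is_cderiveD p v f g df dg :
  is_cderive p v f df -> is_cderive p v g dg ->
  is_cderive p v (fun q => f q + g q) (df + dg).
Proof.
move=> [fr fi] [gr gi]; split.
- rewrite complex_ReD; under eq_fun do rewrite complex_ReD; exact: is_deriveD.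
- rewrite complex_ImD; under eq_fun do rewrite complex_ImD; exact: is_deriveD.
Qed.

Lemma complex_ReM (x y : C) : complex.Re (x * y) =
  complex.Re x * complex.Re y - complex.Im x * complex.Im y.
Proof. by case: x y => [a b] [c d]. Qed.

Lemma complex_ImM (x y : C) : complex.Im (x * y) =
  complex.Re x * complex.Im y + complex.Im x * complex.Re y.
Proof. by case: x y => [a b] [c d]. Qed.

Lemma is_cderiveM p v f g df dg :
  is_cderive p v f df -> is_cderive p v g dg ->
  is_cderive p v (fun q => f q * g q) (f p * dg + df * g p).
Proof.
move=> [fr fi] [gr gi]; split.
- under eq_fun do rewrite complex_ReM.
  apply: (is_derive_eq (is_deriveB (is_deriveM fr gr) (is_deriveM fi gi))).
  by rewrite complex_ReD !complex_ReM /GRing.scale /=; ring.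
- under eq_fun do rewrite complex_ImM.
  apply: (is_derive_eq (is_deriveD (is_deriveM fr gi) (is_deriveM fi gr))).
  by rewrite complex_ImD !complex_ImM /GRing.scale /=; ring.
Qed.

Lemma is_cderive_sum (I : Type) (r : seq I) p v (f : I -> 'rV[R]_N -> C) df :
  (forall i, is_cderive p v (f i) (df i)) ->
  is_cderive p v (fun q => \sum_(i <- r) f i q) (\sum_(i <- r) df i).
Proof.
move=> d; elim: r => [|i r IH].
  by rewrite big_nil; under eq_fun do rewrite big_nil; exact: is_cderive_cst.
by rewrite big_cons; under eq_fun do rewrite big_cons; exact: is_cderiveD.
Qed.

(** Induction by expansion along the first row: differentiating its entries gives the term i = 0,
    differentiating the cofactors gives the terms of the other rows. *)
Lemma is_cderive_det (m : nat) p v (F : 'rV[R]_N -> 'M[C]_m) (dF : 'M[C]_m) :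
  (forall i j, is_cderive p v (fun q => F q i j) (dF i j)) ->
  is_cderive p v (fun q => \det (F q)) (\sum_i \det (set_row i (row i dF) (F p))).
Proof.
elim: m F dF => [|m IH] F dF hF.
  by rewrite big_ord0; under eq_fun do rewrite det_mx00; exact: is_cderive_cst.
under eq_fun do rewrite (expand_det_row _ ord0).
have cof j : is_cderive p v (fun q => cofactor (F q) ord0 j)
   ((-1) ^+ (@ord0 m + j) * \sum_i \det (set_row i (row i (row' ord0 (col' j dF)))
      (row' ord0 (col' j (F p))))).
  have := is_cderiveM (is_cderive_cst p v ((-1) ^+ (@ord0 m + j)))
    (IH (fun q => row' ord0 (col' j (F q))) (row' ord0 (col' j dF)) _).
  rewrite mul0r addr0; apply => a b; rewrite !mxE.
  by under eq_fun do rewrite !mxE; exact: hF.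
have -> : \sum_i \det (set_row i (row i dF) (F p)) =
   \sum_j (F p ord0 j * ((-1) ^+ (@ord0 m + j) *
     \sum_i \det (set_row i (row i (row' ord0 (col' j dF)))
      (row' ord0 (col' j (F p))))) + dF ord0 j * cofactor (F p) ord0 j).
  rewrite big_split /= addrC big_ord_recl det_set_row; congr (_ + _).
    by apply: eq_bigr => j _; rewrite mxE.
  under [RHS]eq_bigr do rewrite mulrA mulr_sumr.
  rewrite [RHS]exchange_big; apply: eq_bigr => i _ /=.
  rewrite (expand_det_row _ ord0); apply: eq_bigr => j _.
  rewrite mxE /= -mulrA; congr (_ * (_ * \det _)); apply/matrixP => a b.
  by rewrite !mxE (inj_eq (@lift_inj _ _)).
by apply: is_cderive_sum => j; apply: is_cderiveM.
Qed.

End Derivatives.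

Section ComplexDerivative.
Local Open Scope complex_scope.
Variables (R : realType) (N : nat) (p : 'rV[R]_N).
Local Notation C := R[i].

Definition cderive (f : 'rV[R]_N -> C) (v : 'rV[R]_N) : C :=
  'D_v (fun q => complex.Re (f q)) p +i* 'D_v (fun q => complex.Im (f q)) p.

Definition has_cgradient (f : 'rV[R]_N -> C) :=
  has_gradient (fun q => complex.Re (f q)) p /\
  has_gradient (fun q => complex.Im (f q)) p.

Lemma cderive_val f v d : is_cderive p v f d -> cderive f v = d.
Proof.
by move=> [fr fi]; rewrite /cderive (@derive_val _ _ _ _ _ _ _ fr)
   (@derive_val _ _ _ _ _ _ _ fi); case: d {fr fi}.
Qed.

Lemma has_cgradient_is_cderive f v :
  has_cgradient f -> is_cderive p v f (cderive f v).
Proof. by move=> [[df _] [dg _]]; split; exact: DeriveDef. Qed.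

Lemma cderive_gradient f v : has_cgradient f ->
  cderive f v = \sum_k (v 0 k)%:C * cderive f (delta_mx 0 k).
Proof.
move=> [[_ lf] [_ lg]]; apply/eqP; rewrite eq_complex; apply/andP; split; apply/eqP.
  by rewrite /= lf raddf_sum; apply: eq_bigr => k _; rewrite /= mul0r subr0.
by rewrite /= lg raddf_sum; apply: eq_bigr => k _; rewrite /= mul0r addr0.
Qed.

Lemma dextC_cderive (k : nat) (alpha : 'rV[R]_N -> 'M[R]_(k, N) -> C)
    (v : 'M[R]_(k.+1, N)) :
  dextC alpha p v =
  \sum_(a < k.+1) (-1) ^+ a * cderive (fun q => alpha q (row' a v)) (row a v).
Proof.
have sgn (a : nat) : (-1) ^+ a = (((-1) ^+ a)%:C : C) by rewrite rmorphXn rmorphN1.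
apply/eqP; rewrite eq_complex; apply/andP; split; apply/eqP.
  by rewrite /= raddf_sum; apply: eq_bigr => a _; rewrite sgn /= mul0r subr0.
by rewrite /= raddf_sum; apply: eq_bigr => a _; rewrite sgn /= mul0r addr0.
Qed.

End ComplexDerivative.

Section Gradient.
Variables (R : realType) (N : nat) (p : 'rV[R]_N).

Lemma has_gradientM (f g : 'rV[R]_N -> R) :
  has_gradient f p -> has_gradient g p -> has_gradient (fun q => f q * g q) p.
Proof.
move=> [df lf] [dg lg]; split=> v; first exact: derivableM.
rewrite (@deriveM _ _ f g) // lf lg !scaler_sumr -big_split.
apply: eq_bigr => k _; rewrite (@deriveM _ _ f g) // /GRing.scale /=; ring.
Qed.

Lemma deriveM_real (f g : 'rV[R]_N -> R) v :
  has_gradient f p -> has_gradient g p ->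
  'D_v (fun q => f q * g q) p = f p * 'D_v g p + g p * 'D_v f p.
Proof. by move=> [df _] [dg _]; rewrite (@deriveM _ _ f g). Qed.

Lemma has_gradient_cst (c : R) : has_gradient (fun=> c) p.
Proof. exact/differentiable_has_gradient/differentiable_cst. Qed.

End Gradient.

(** * The exterior derivative of [Omega] at one point *)

Section Pointwise.
Local Open Scope complex_scope.
Variables (R : realType) (n : nat) (b g : 'rV[R]_(n + n) -> 'M[R]_n)
  (p : 'rV[R]_(n + n)).
Hypothesis b_diff : forall i j, differentiable (fun q => b q i j) p.
Hypothesis g_diff : forall i j, differentiable (fun q => g q i j) p.
Hypothesis ginv_pos : forall u : 'rV[R]_n, u != 0 -> 0 < (u *m ginv g p *m u^T) 0 0.
Local Notation C := R[i].

Lemma det_g_gt0 : 0 < \det (g p).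
Proof. by have := det_posdef_gt0 ginv_pos; rewrite det_inv invr_gt0. Qed.

Lemma volume_gt0 : 0 < volume g p.
Proof. by rewrite sqrtr_gt0 det_g_gt0. Qed.

Lemma volume_gradient : has_gradient (volume g) p.
Proof.
apply: differentiable_has_gradient.
rewrite -[volume g]/(Num.sqrt \o (fun q => \det (g q))).
apply: differentiable_comp; first exact: differentiable_det.
by apply/derivable1_diffP; have [] := is_derive1_sqrt det_g_gt0.
Qed.

Lemma ginv_gradient i j : has_gradient (fun q => ginv g q i j) p.
Proof.
have dg := differentiable_det g_diff.
(* [invmx] is defined by cases on invertibility; Cramer's formula holds near [p], where the
   determinant stays positive. *)
apply: (@near_has_gradient _ _ (fun q => (\det (g q))^-1 * cofactor (g q) j i)).
  have : \forall q \near p, 0 < \det (g q).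
    exact: (cvgr_gt _ (differentiable_continuous dg) _ det_g_gt0).
  apply: filterS => q det_gt0.
  by rewrite /ginv /invmx unitmxE unitfE gt_eqF // !mxE.
apply: differentiable_has_gradient.
apply: differentiableM; first by apply: differentiableV; rewrite // gt_eqF // det_g_gt0.
apply: differentiableM; first exact: differentiable_cst.
by apply: differentiable_det => a c; under eq_fun do rewrite !mxE.
Qed.

Lemma b_gradient i j : has_gradient (fun q => b q i j) p.
Proof. exact: differentiable_has_gradient. Qed.

Definition betam (q : 'rV[R]_(n + n)) : 'M[C]_n := \matrix_(i, j) beta b g q i j.

Lemma beta_gradient i j : has_cgradient p (fun q => beta b g q i j).
Proof. by split; [exact: b_gradient|exact: ginv_gradient]. Qed.

Lemma volumeC_gradient : has_cgradient p (fun q => (volume g q)%:C).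
Proof. by split; [exact: volume_gradient|exact: has_gradient_cst]. Qed.

Definition dX k (f : 'rV[R]_(n + n) -> C) : C :=
  cderive p f (delta_mx 0 (lshift n k)).
Definition dY k (f : 'rV[R]_(n + n) -> C) : C :=
  cderive p f (delta_mx 0 (rshift n k)).
(** This differentiates along the complex vector field D_k, which every theta_i annihilates; [dX]
    and [dH] are thus the components of a differential in the coframe of the theta's and dy's. *)
Definition dH k (f : 'rV[R]_(n + n) -> C) : C :=
  dY k f - \sum_l beta b g p l k * dX l f.

Definition vol_coef j : C :=
  dH j (fun q => (volume g q)%:C) -
  (volume g p)%:C * \sum_i dX i (fun q => beta b g q i j).
Definition beta_coef k i j : C := dH k (fun q => beta b g q i j).

(** Transposed, so that tangent vectors index columns and omitting a vector becomes [col']. *)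
Definition xpart (v : 'M[R]_(n.+1, n + n)) : 'M[C]_(n, n.+1) :=
  map_mx (real_complex R) (lsubmx v)^T.
Definition ypart (v : 'M[R]_(n.+1, n + n)) : 'M[C]_(n, n.+1) :=
  map_mx (real_complex R) (rsubmx v)^T.

(** The beta terms contained in theta_k cancel those subtracted in [dH] once the two summation
    indices are exchanged. *)
Lemma row_cderive (f : 'rV[R]_(n + n) -> C) (v : 'M[R]_(n.+1, n + n)) :
  has_cgradient p f ->
  \row_a cderive p f (row a v) =
  \sum_k dX k f *: row k (xpart v + (betam p) *m ypart v) +
  \sum_k dH k f *: row k (ypart v).
Proof.
move=> gf; apply/rowP => a; rewrite mxE cderive_gradient // big_split_ord /=.
set x := fun k => (v a (lshift n k))%:C; set y := fun k => (v a (rshift n k))%:C.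
have -> : (\sum_k dX k f *: row k (xpart v + (betam p) *m ypart v) +
    \sum_k dH k f *: row k (ypart v)) 0 a =
    (\sum_k x k * dX k f + \sum_k \sum_l dX k f * beta b g p k l * y l) +
    (\sum_k y k * dY k f - \sum_k \sum_l dX l f * beta b g p l k * y k).
  rewrite mxE !summxE; congr (_ + _); [rewrite -big_split|rewrite -sumrB];
    apply: eq_bigr => k _ /=.
    rewrite !mxE mulrDr mulr_sumr; congr (_ + _); first by rewrite mulrC.
    by apply: eq_bigr => l _; rewrite !mxE mulrA.
  rewrite !mxE mulrBl mulr_suml; congr (_ - _); first by rewrite mulrC.
  by apply: eq_bigr => l _; ring.
rewrite [X in _ = _ + X + _]exchange_big /= addrACA subrr addr0.
by congr (_ + _); apply: eq_bigr => k _; rewrite mxE.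
Qed.

Lemma Omega_row' (q : 'rV[R]_(n + n)) (v : 'M[R]_(n.+1, n + n)) a :
  Omega b g q (row' a v) =
  (volume g q)%:C *
  \det (col' a (xpart v + betam q *m ypart v)).
Proof.
rewrite /Omega /wedge -det_tr; congr (_ * \det _); apply/matrixP => i j.
rewrite !mxE; congr (_ + _); first by rewrite /dx !mxE.
by apply: eq_bigr => k _; rewrite /dy !mxE.
Qed.

(** The dx_i and dy_j have constant coefficients, so only V and the beta_ij are differentiated; in
    row i, theta_i is replaced by the combination of the dy_j with coefficients d beta_ij. *)
Lemma cderive_Omega (v : 'M[R]_(n.+1, n + n)) (a : 'I_n.+1) :
  cderive p (fun q => Omega b g q (row' a v)) (row a v) =
  cderive p (fun q => (volume g q)%:C) (row a v) *
    \det (col' a (xpart v + (betam p) *m ypart v)) +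
  (volume g p)%:C * \sum_i \sum_j cderive p (fun q => beta b g q i j) (row a v) *
    \det (col' a (set_row i (row j (ypart v)) (xpart v + (betam p) *m ypart v))).
Proof.
set P := xpart v + _.
pose D : 'M[C]_n := (\matrix_(i, j) cderive p (fun q => beta b g q i j) (row a v)) *m
  col' a (ypart v).
under eq_fun do rewrite Omega_row'.
rewrite (cderive_val (is_cderiveM (has_cgradient_is_cderive (row a v) volumeC_gradient)
  (@is_cderive_det _ _ _ _ _ _ D _))) => [|i j].
  rewrite addrC; congr (_ + _ * _); apply: eq_bigr => i _.
  rewrite det_set_row; under [RHS]eq_bigr do rewrite col'_set_row det_set_row mulr_sumr.
  rewrite exchange_big /=; apply: eq_bigr => k _; rewrite !mxE mulr_suml.
  by apply: eq_bigr => j _; rewrite !mxE -mulrA.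
under eq_fun do rewrite !mxE.
rewrite -[D i j]add0r; apply: is_cderiveD; first exact: is_cderive_cst.
rewrite mxE; apply: is_cderive_sum => k.
under eq_fun do rewrite !mxE.
have := is_cderiveM (has_cgradient_is_cderive (row a v) (beta_gradient i k))
  (is_cderive_cst p (row a v) (ypart v k (lift a j))).
by rewrite mulr0 add0r !mxE.
Qed.

(** The alternating sum defining d is the expansion of [det_cons] along its first row. This gives
    the left side of [det_cons_leibniz], whose right side is [leibniz_form]. *)
Lemma dextC_Omega (v : 'M[R]_(n.+1, n + n)) :
  dextC (Omega b g) p v =
  leibniz_form (betam p) (volume g p)%:C vol_coef beta_coef (xpart v) (ypart v).
Proof.
rewrite /leibniz_form -(det_cons_leibniz (xpart v + (betam p) *m ypart v) (ypart v)
  (volume g p)%:C (fun k => dX k (fun q => (volume g q)%:C)) _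
  (fun k i j => dX k (fun q => beta b g q i j))).
rewrite -row_cderive; last exact: volumeC_gradient.
under [X in _ = _ + _ * X]eq_bigr => i _ do under eq_bigr => j _ do
  rewrite -(row_cderive v (beta_gradient i j)).
rewrite det_consE dextC_cderive.
under [LHS]eq_bigr => a _ do rewrite (cderive_Omega v a) mulrDr.
rewrite big_split; congr (_ + _) => /=; first by apply: eq_bigr => a _; rewrite mxE.
under [LHS]eq_bigr do rewrite mulrCA; rewrite -mulr_sumr; congr (_ * _).
under [LHS]eq_bigr do rewrite mulr_sumr.
rewrite [LHS]exchange_big; apply: eq_bigr => i _ /=.
under [LHS]eq_bigr do rewrite mulr_sumr.
rewrite [LHS]exchange_big; apply: eq_bigr => j _ /=.
by rewrite det_consE; apply: eq_bigr => a _; rewrite mxE.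
Qed.

Lemma closed_atP : (forall v, dextC (Omega b g) p v = 0) <->
  (forall j, vol_coef j = 0) /\ (forall k i j, beta_coef k i j = beta_coef j i k).
Proof.
have V0 : (volume g p)%:C != 0 by rewrite fmorph_eq0 gt_eqF // volume_gt0.
split=> [closed|[d0 sym] v]; last by rewrite dextC_Omega leibniz_form_eq0.
(* [dextC] takes real vectors but [leibniz_form] complex matrices: the frame [t] is given over every
   ring, and its real version must map to the complex one. *)
have part (t : forall T : comNzRingType, 'M[T]_(n, n.+1) * 'M[T]_(n, n.+1)) :
    map_mx (real_complex R) (t R).1 = (t C).1 ->
    map_mx (real_complex R) (t R).2 = (t C).2 ->
    leibniz_form (betam p) (volume g p)%:C vol_coef beta_coef (t C).1 (t C).2 = 0.
  move=> t1 t2; have := closed (row_mx (t R).1^T (t R).2^T).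
  by rewrite dextC_Omega /xpart /ypart row_mxKl row_mxKr !trmxK t1 t2.
(* These come first, since the frames with two base vectors isolate [beta_coef] only once [vol_coef]
   vanishes. *)
have d0 j : vol_coef j = 0.
  rewrite -(leibniz_form_one_base (betam p) (volume g p)%:C vol_coef beta_coef j).
  by apply: (part (fun T => one_base_frame T j));
    apply/matrixP => x y; rewrite !mxE rmorph_nat.
split=> // k i j; apply/eqP; rewrite -subr_eq0; apply/eqP/(mulfI V0).
rewrite mulr0 -(leibniz_form_two_base (betam p) _ _ i j k d0).
by apply: (part (fun T => two_base_frame T i j k));
  apply/matrixP => x y; rewrite !mxE rmorph_nat.
Qed.

(** * Real and imaginary parts of the coefficients; curvature and covariant derivative *)

Local Notation h := (ginv g).
Definition rX k (f : 'rV[R]_(n + n) -> R) : R := 'D_(delta_mx 0 (lshift n k)) f p.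

Lemma Re_beta_coef k i j : complex.Re (beta_coef k i j) =
  'D_(d_dy R k) (fun q => b q i j) p -
  \sum_l (b p l k * rX l (fun q => b q i j) - h p l k * rX l (fun q => h q i j)).
Proof.
by rewrite /beta_coef /dH raddfB raddf_sum.
Qed.

Lemma Im_beta_coef k i j : complex.Im (beta_coef k i j) =
  'D_(d_dy R k) (fun q => h q i j) p -
  \sum_l (b p l k * rX l (fun q => h q i j) + h p l k * rX l (fun q => b q i j)).
Proof.
by rewrite /beta_coef /dH raddfB raddf_sum.
Qed.

Lemma Re_vol_coef j : complex.Re (vol_coef j) =
  'D_(d_dy R j) (volume g) p -
  \sum_l (b p l j * rX l (volume g) + volume g p * rX l (fun q => b q l j)).
Proof.
rewrite /vol_coef /dH 2!raddfB /= -addrA -opprD; congr (_ - _).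
rewrite complex_ReM /= mul0r subr0 !raddf_sum /= mulr_sumr -big_split /=.
apply: eq_bigr => l _; congr (_ + _).
by rewrite [X in _ - _ * X]derive_cst mulr0 subr0.
Qed.

Lemma Im_vol_coef j : complex.Im (vol_coef j) =
  - \sum_l rX l (fun q => h q l j * volume g q).
Proof.
rewrite /vol_coef /dH 2!raddfB /= [X in X - _ - _]derive_cst sub0r -opprD; congr (- _).
rewrite complex_ImM /= mul0r addr0 !raddf_sum /= mulr_sumr -big_split /=.
apply: eq_bigr => l _; rewrite [X in _ * X + _]derive_cst mulr0 add0r.
rewrite /rX (deriveM_real _ (ginv_gradient l j) volume_gradient).
by congr (_ + _).
Qed.

Lemma derive_vert (xi : 'rV[R]_n) (f : 'rV[R]_(n + n) -> R) :
  has_gradient f p -> 'D_(vert xi) f p = \sum_k xi 0 k * rX k f.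
Proof.
move=> [_ ->]; rewrite big_split_ord /= [X in _ + X]big1 ?addr0 => [|k _].
  by apply: eq_bigr => k _; rewrite row_mxEl.
by rewrite row_mxEr mxE mul0r.
Qed.

Lemma derive_vert_rV (xi : 'rV[R]_n) (F : 'rV[R]_(n + n) -> 'rV[R]_n) i :
  (forall j, has_gradient (fun q => F q 0 j) p) ->
  ('D_(vert xi) F p) 0 i = \sum_k xi 0 k * rX k (fun q => F q 0 i).
Proof.
move=> gF; have dF : derivable F p (vert xi).
  by apply/derivable_mxP => a j; rewrite ord1; case: (gF j).
by rewrite (derive_mx dF) mxE; exact: derive_vert (gF i).
Qed.

Lemma dy2_anti l m (u : 'M[R]_(2, n)) : dy2 m l u = - dy2 l m u.
Proof. by rewrite /dy2; ring. Qed.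

Lemma sum_dy2_anti (t : 'I_n -> 'I_n -> R) (u : 'M[R]_(2, n)) :
  \sum_l \sum_m dy2 l m u * t m l = - \sum_l \sum_m dy2 l m u * t l m.
Proof.
rewrite exchange_big -sumrN; apply: eq_bigr => l _; rewrite -sumrN.
by apply: eq_bigr => m _; rewrite dy2_anti mulNr.
Qed.

(** Relabelling l and m in the second half of the Lie bracket reverses dy_l /\ dy_m and so turns its
    minus sign into a plus: the bracket is symmetric in [v] and [w]. *)
Lemma ybracketE (v w : 'rV[R]_(n + n) -> 'M[R]_n) (u : 'M[R]_(2, n)) i :
  (forall i j, has_gradient (fun q => v q i j) p) ->
  (forall i j, has_gradient (fun q => w q i j) p) ->
  ybracket v w p u 0 i = \sum_l \sum_m dy2 l m u *
    \sum_k (v p k l * rX k (fun q => w q i m) + w p k l * rX k (fun q => v q i m)).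
Proof.
move=> gv gw; rewrite summxE.
pose A (v w : 'rV[R]_(n + n) -> 'M[R]_n) l m := \sum_k v p k l * rX k (fun q => w q i m).
transitivity (\sum_l \sum_m (dy2 l m u * A v w l m - dy2 l m u * A w v m l)).
  apply: eq_bigr => l _; rewrite summxE; apply: eq_bigr => m _.
  rewrite mxE -mulrBr; congr (_ * _).
  have gf (z : 'rV[R]_(n + n) -> 'M[R]_n) (c j : 'I_n) :
      (fun q => vfield z c q 0 j) = (fun q => z q j c).
    by apply/funext => q; rewrite mxE.
  rewrite 2!mxE !derive_vert_rV; try by move=> j; rewrite gf.
  by rewrite !gf; congr (_ - _); apply: eq_bigr => k _; rewrite mxE.
under eq_bigr do rewrite sumrB; rewrite sumrB (sum_dy2_anti (A w v)) opprK -big_split.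
apply: eq_bigr => l _; rewrite -big_split; apply: eq_bigr => m _ /=.
by rewrite -mulrDr -big_split.
Qed.

Lemma d_yE (v : 'rV[R]_(n + n) -> 'M[R]_n) (u : 'M[R]_(2, n)) i :
  d_y v p u 0 i = \sum_k \sum_j dy2 k j u * 'D_(d_dy R k) (fun q => v q i j) p.
Proof.
rewrite mxE exchange_big; apply: eq_bigr => k _; apply: eq_bigr => j _.
by rewrite mulrC.
Qed.

Lemma nablaE u i :
  nabla b h p u 0 i = \sum_k \sum_j dy2 k j u * complex.Im (beta_coef k i j).
Proof.
rewrite /nabla mxE d_yE mxE ybracketE; [|exact: b_gradient|exact: ginv_gradient].
rewrite -sumrB; apply: eq_bigr => k _; rewrite -sumrB; apply: eq_bigr => j _.
by rewrite Im_beta_coef mulrBr.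
Qed.

(** With equal arguments the two summands of [ybracketE] coincide, which cancels the factor one
    half; the opposite signs of the two brackets come from the square of the imaginary unit. *)
Lemma curvatureE u i :
  (curvature b p u + 2^-1 *: ybracket h h p u) 0 i =
  \sum_k \sum_j dy2 k j u * complex.Re (beta_coef k i j).
Proof.
have gb := b_gradient; have gh := ginv_gradient.
have curvE (x y z : 'rV[R]_n) (c : R) :
    (x - c *: y + c *: z) 0 i = x 0 i - c * (y 0 i - z 0 i).
  by rewrite !mxE; ring.
rewrite /curvature curvE d_yE !ybracketE // -sumrB.
rewrite mulr_sumr -sumrB; apply: eq_bigr => k _.
rewrite -sumrB mulr_sumr -sumrB; apply: eq_bigr => j _.
rewrite Re_beta_coef [RHS]mulrBr; congr (_ - _); rewrite -!mulrBr mulrCA; congr (_ * _).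
rewrite -sumrB mulr_sumr; apply: eq_bigr => l _.
by set x := _ * rX l _; set y := _ * rX l _; field.
Qed.

Lemma sum_dy2_eq0P (t : 'I_n -> 'I_n -> 'I_n -> R) :
  (forall u i, \sum_k \sum_j dy2 k j u * t k i j = 0) <->
  (forall k i j, t k i j = t j i k).
Proof.
split=> [t0 k i j|sym u i]; last first.
  have /eqP := sum_dy2_anti (fun k j => t k i j) u.
  under eq_bigr do under eq_bigr do rewrite sym.
  by rewrite -subr_eq0 opprK -mulr2n mulrn_eq0 /= => /eqP.
(* With d/dy_k and d/dy_j as the rows of [u], the sum collapses to [t k i j - t j i k]. *)
pose u : 'M[R]_(2, n) := \matrix_(a, c) (c == if a == ord0 then k else j)%:R.
have dyE l m : dy2 l m u =
    (l == k)%:R * (m == j)%:R - (l == j)%:R * (m == k)%:R.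
  by rewrite /dy2 !mxE.
have := t0 u i.
have pick a c : \sum_l \sum_m (l == a)%:R * (m == c)%:R * t l i m = t a i c.
  rewrite (bigD1 a) //= [X in _ + X]big1 ?addr0 => [|l la]; last first.
    by rewrite big1 // => m _; rewrite (negPf la) !mul0r.
  rewrite (bigD1 c) //= [X in _ + X]big1 ?addr0 => [|m mc]; last first.
    by rewrite (negPf mc) mulr0 mul0r.
  by rewrite !eqxx !mul1r.
under eq_bigr do under eq_bigr do rewrite dyE mulrBl.
under eq_bigr do rewrite sumrB.
by rewrite sumrB !pick => /eqP; rewrite subr_eq0 => /eqP.
Qed.

Lemma curvature_nablaP :
  ((forall u, curvature b p u + 2^-1 *: ybracket h h p u = 0) /\
   (forall u, nabla b h p u = 0)) <-> (forall k i j, beta_coef k i j = beta_coef j i k).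
Proof.
split=> [[F0 N0] k i j|sym].
  apply/eqP; rewrite eq_complex; apply/andP; split; apply/eqP.
    have /sum_dy2_eq0P -> // : forall u i,
      \sum_k \sum_j dy2 k j u * complex.Re (beta_coef k i j) = 0.
    by move=> u i'; rewrite -curvatureE F0 mxE.
  have /sum_dy2_eq0P -> // : forall u i,
    \sum_k \sum_j dy2 k j u * complex.Im (beta_coef k i j) = 0.
  by move=> u i'; rewrite -nablaE N0 mxE.
split=> u; apply/rowP => i; rewrite [RHS]mxE.
  rewrite curvatureE; move: u i.
  apply/(sum_dy2_eq0P (fun k i j => complex.Re (beta_coef k i j))).
  by move=> k i j; rewrite sym.
rewrite nablaE; move: u i.
apply/(sum_dy2_eq0P (fun k i j => complex.Im (beta_coef k i j))).
by move=> k i j; rewrite sym.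
Qed.

(** * Parallelism of the volume form *)

Lemma volume_formE q v : volume_form g q v = volume g q * \det v.
Proof.
by rewrite /volume_form /wedge; congr (_ * \det _); apply/matrixP => i j; rewrite !mxE.
Qed.

Lemma derive_volume_form w v :
  'D_w (fun q => volume_form g q v) p = \det v * 'D_w (volume g) p.
Proof.
under eq_fun do rewrite volume_formE.
rewrite deriveM_real; [|exact: volume_gradient|exact: has_gradient_cst].
by rewrite [X in _ * X + _]derive_cst mulr0 add0r.
Qed.

Lemma lie_derivative_volume j v :
  lie_derivative (vfield b j) (volume_form g) p v =
  \sum_l (b p l j * rX l (volume g) + volume g p * rX l (fun q => b q l j)) * \det v.
Proof.
(* For constant fields v_i the bracket with b_j is - v_i J, so the correction terms add up to V det
   v times the trace of [J], the fibre divergence of b_j. *)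
pose J : 'M[R]_n := \matrix_(k, c) rX k (fun q => b q c j).
have lieE i : lie (vfield b j) (fun=> row i v) p = - (row i v *m J).
  rewrite /lie derive_cst sub0r; congr (- _); apply/rowP => c.
  have gf d : (fun q => vfield b j q 0 d) = (fun q => b q d j).
    by apply/funext => q; rewrite mxE.
  rewrite derive_vert_rV => [|d]; last by rewrite gf; exact: b_gradient.
  by rewrite !mxE; apply: eq_bigr => k _; rewrite gf !mxE.
rewrite /lie_derivative derive_volume_form derive_vert; last exact: volume_gradient.
have -> : \sum_(i < n) volume_form g p (\matrix_(a < n)
    (if a == i then lie (vfield b j) (fun=> row i v) p else row a v)) =
    - (volume g p * \sum_i \det (set_row i (row i v *m J) v)).
  rewrite mulr_sumr -sumrN; apply: eq_bigr => i _.
  rewrite volume_formE -mulrN; congr (_ * _).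
  transitivity (\det (set_row i (- (row i v *m J)) v)).
    congr (\det _); apply/matrixP => a c; rewrite [LHS]mxE [RHS]mxE.
    by case: eqP => _; [rewrite lieE|rewrite mxE].
  rewrite !det_set_row -sumrN; apply: eq_bigr => c _.
  by rewrite [in LHS]mxE mulNr.
rewrite sum_det_set_row_mulmx opprK -mulr_suml big_split /= mulrDl mulrC.
congr (_ * _ + _); first by apply: eq_bigr => k _; rewrite mxE.
by rewrite mulrA -mulr_sumr; do 2 congr (_ * _); apply: eq_bigr => k _; rewrite mxE.
Qed.

Lemma parallelP : (forall j v, 'D_(d_dy R j) (fun q => volume_form g q v) p -
    lie_derivative (vfield b j) (volume_form g) p v = 0) <->
  (forall j, complex.Re (vol_coef j) = 0).
Proof.
have E j v : 'D_(d_dy R j) (fun q => volume_form g q v) p -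
    lie_derivative (vfield b j) (volume_form g) p v = complex.Re (vol_coef j) * \det v.
  by rewrite derive_volume_form lie_derivative_volume -mulr_suml Re_vol_coef mulrBl mulrC.
split=> [par j|r0 j v]; last by rewrite E r0 mul0r.
(* A form of top degree is determined by its value on the standard frame. *)
by have := par j 1%:M; rewrite E det1 mulr1.
Qed.

Lemma dfib_dx_fib i v : dfib (dx_fib i) p v = 0.
Proof.
rewrite /dfib /dext big1 // => a _; by rewrite /dx_fib derive_cst mulr0.
Qed.

End Pointwise.

(** * Hodge star and codifferential of the dx_i *)

Lemma sum_minors_trace (T : comNzRingType) (m n : nat) (e : (1 + m)%N = n)
    (c : 'M[T]_n) (v : 'M[T]_(m.+1, n)) :
  \sum_(k < m.+1) (-1) ^+ k * \sum_j (\sum_l v k l * c l j) *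
    \det (castmx (e, erefl n) (col_mx (delta_mx 0 j) (row' k v))) =
  \tr c * \det (castmx (e, erefl n) (v : 'M[T]_(1 + m, n))).
Proof.
case: n / e c v => c v; rewrite castmx_id.
(* The left side is this trace written out entry by entry: the minors with first row [delta_mx 0 j]
   are, up to sign, the entries of the adjugate. *)
have -> : \tr c * \det (v : 'M[T]_(1 + m)) = \tr (v *m c *m \adj (v : 'M[T]_(1 + m))).
  by rewrite mxtrace_mulC mulmxA mul_adj_mx mul_scalar_mx mxtraceZ mulrC.
apply: eq_bigr => k _; rewrite mxE mulr_sumr; apply: eq_bigr => j _.
rewrite mulrCA [(v *m c) k j]mxE; congr (_ * _).
rewrite castmx_id [\adj _ _ _]mxE (expand_det_row _ (lshift m (0 : 'I_1))).
rewrite (bigD1 j) //= big1 ?addr0 => [|a aj]; last first.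
  by rewrite col_mxEu mxE (negPf aj) mul0r.
rewrite col_mxEu mxE !eqxx mul1r /cofactor add0n mulrA -exprD.
congr (_ * \det _); apply/matrixP => x y; rewrite [LHS]mxE [LHS]mxE.
have -> : lift (lshift m (0 : 'I_1)) x = rshift 1 x by apply: val_inj.
by rewrite col_mxEd !mxE.
Qed.

Section Harmonic.
Variables (R : realType) (n : nat) (g : 'rV[R]_(n + n) -> 'M[R]_n)
  (p : 'rV[R]_(n + n)).
Hypothesis hV : forall i j, has_gradient (fun q => ginv g q i j * volume g q) p.

Lemma hodge_dx (kn : (1 <= n)%N) i q w :
  hodge kn g (dx_fib i) q w =
  \sum_j ginv g q j i * volume g q *
    \det (castmx (subnKC kn, erefl n) (col_mx (delta_mx 0 j) w)).
Proof.
rewrite /hodge (_ : 1`! = 1%N) // invr1 mul1r.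
rewrite (reindex (fun j : 'I_n => [ffun _ : 'I_1 => j])) /=; last first.
  exists (fun J : {ffun 'I_1 -> 'I_n} => J 0) => [j _|J _]; first by rewrite ffunE.
  by apply/ffunP => x; rewrite ffunE [x]ord1.
apply: eq_bigr => j _; rewrite /dx_fib !mxE ffunE.
congr (_ * \det (castmx _ (col_mx _ _))).
by apply/rowP => a; rewrite !mxE ffunE eqxx eq_sym.
Qed.

(** The star of dx_i is the contraction of dx_1 /\ .. /\ dx_n with the vector field of components V
    g^ji, and its fibrewise differential is the divergence of that field times dx_1 /\ .. /\
    dx_n. *)
Lemma dfib_hodge_dx (kn : (1 <= n)%N) i v :
  dfib (hodge kn g (dx_fib i)) p v =
  (\sum_l rX p l (fun q => ginv g q l i * volume g q)) *
  \det (castmx (subnKC kn, erefl n) (v : 'M[R]_(1 + (n - 1), n))).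
Proof.
pose c : 'M[R]_n := \matrix_(l, j) rX p l (fun q => ginv g q j i * volume g q).
have -> : \sum_l rX p l (fun q => ginv g q l i * volume g q) = \tr c.
  by apply: eq_bigr => l _; rewrite mxE.
rewrite -sum_minors_trace; apply: eq_bigr => k _; congr (_ * _).
under eq_fun do rewrite hodge_dx.
pose d j := \det (castmx (subnKC kn, erefl n) (col_mx (delta_mx 0 j) (row' k v))).
have hd j : has_gradient (fun q => ginv g q j i * volume g q * d j) p.
  by apply: has_gradientM => //; exact: has_gradient_cst.
rewrite (_ : (fun _ => _) =
  \sum_j (fun q => ginv g q j i * volume g q * d j)); last first.
  by apply/funext => q; rewrite fct_sumE.
rewrite derive_sum => [|j]; last by case: (hd j).
apply: eq_bigr => j _; rewrite deriveM_real //; last exact: has_gradient_cst.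
rewrite derive_cst mulr0 add0r derive_vert // mulrC; congr (_ * _).
by apply: eq_bigr => l _; rewrite !mxE.
Qed.

Lemma harmonic_dxP (kn : (1 <= n)%N) i :
  ((forall v, dfib (dx_fib i) p v = 0) /\
   (forall w, dfib (hodge kn g (dx_fib i)) p w = 0)) <->
  \sum_l rX p l (fun q => ginv g q l i * volume g q) = 0.
Proof.
split=> [[_ h0]|s0]; last first.
  by split=> [v|w]; [exact: dfib_dx_fib|rewrite dfib_hodge_dx s0 mul0r].
(* The standard frame, cast to [1 + (n - 1)] rows, makes the determinant equal to 1. *)
have := h0 (castmx (esym (subnKC kn), erefl n) 1%:M).
by rewrite dfib_hodge_dx castmxKV det1 mulr1.
Qed.

End Harmonic.

(** * Assembly of the pointwise equivalences over all charts *)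

Theorem corollary5p15 (R : realType) (n : nat) (B : smooth_manifold R n)
    (L : lagrangian_lattice B)
    (b g : chart B -> 'rV[R]_(n + n) -> 'M[R]_n)
    (b_smooth : forall a i j, smooth_on (tdom a) (fun p => b a p i j))
    (g_smooth : forall a i j, smooth_on (tdom a) (fun p => g a p i j))
    (b_sym : forall a p, tdom a p -> (b a p)^T = b a p)
    (g_unit : forall a p, tdom a p -> g a p \in unitmx)
    (ginv_posdef : forall a p, tdom a p -> sym_posdef (ginv (g a) p))
    (Omega_global : globally_defined L (fun a => Omega (b a) (g a))) :
  closed_form (fun a => Omega (b a) (g a)) <->
  [/\ forall a p, tdom a p -> forall u,
        curvature (b a) p u
          + 2^-1 *: ybracket (ginv (g a)) (ginv (g a)) p u = 0,
      forall a p, tdom a p -> forall u, nabla (b a) (ginv (g a)) p u = 0,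
      forall a i, dx_harmonic_on (tdom a) (g a) i
    & forall a, parallel_on (tdom a) (b a) (volume_form (g a))].
Proof.
have b_diff a p : tdom a p -> forall i j, differentiable (fun q => b a q i j) p.
  by move=> ap i j; have [+ _] := b_smooth a i j 1%N; apply.
have g_diff a p : tdom a p -> forall i j, differentiable (fun q => g a q i j) p.
  by move=> ap i j; have [+ _] := g_smooth a i j 1%N; apply.
have pos a p (ap : tdom a p) := (ginv_posdef a p ap).2.
have hV a p : tdom a p ->
    forall i j, has_gradient (fun q => ginv (g a) q i j * volume (g a) q) p.
  move=> ap i j; apply: has_gradientM.
    exact: ginv_gradient (g_diff _ _ ap) (pos _ _ ap) _ _.
  exact: volume_gradient (g_diff _ _ ap) (pos _ _ ap).
have atP a p (ap : tdom a p) := closed_atP (b_diff _ _ ap) (g_diff _ _ ap) (pos _ _ ap).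
have cnP a p (ap : tdom a p) :=
  curvature_nablaP (b_diff _ _ ap) (g_diff _ _ ap) (pos _ _ ap).
have parP a p (ap : tdom a p) :=
  parallelP (b_diff _ _ ap) (g_diff _ _ ap) (pos _ _ ap).
have ImE a p (ap : tdom a p) :=
  Im_vol_coef (b a) (g_diff _ _ ap) (pos _ _ ap).
split=> [closed|[F0 N0 harm par] a p v ap].
  have div0 a p (ap : tdom a p) := ((atP a p ap).1 (fun v => closed a p v ap)).1.
  have sym a p (ap : tdom a p) := ((atP a p ap).1 (fun v => closed a p v ap)).2.
  split=> [a p ap|a p ap|a i p ap|a p ap].
  - exact: ((cnP a p ap).2 (sym a p ap)).1.
  - exact: ((cnP a p ap).2 (sym a p ap)).2.
  - apply/harmonic_dxP; first exact: hV.
    by apply/eqP; rewrite -oppr_eq0 -ImE // div0.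
  - by apply/parP => // j; rewrite div0.
move: v; apply/(atP a p ap); split; last first.
  by apply/cnP => //; split; [exact: F0|exact: N0].
(* The real part of the coefficient vanishes by parallelism, the imaginary part by harmonicity. *)
move=> j; apply/eqP; rewrite eq_complex; apply/andP; split; apply/eqP.
  by move: j; apply/parP => //; exact: par.
rewrite ImE //; apply/eqP; rewrite oppr_eq0; apply/eqP.
exact: (harmonic_dxP (hV a p ap) _ j).1 (harm a j p ap).
Qed.
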